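(* For $n\in\mathbb{N}$ write $n=2^j m$ with $j\in\mathbb{N}\cup\{0\}$ and $m$ odd. Then $$\sum_{\substack{k=1\\ \gcd(k,n)=1}}^n c_n(k^2-1)=\begin{cases} d_j\,\psi(m), & \text{if } j\in\{0,1,2,3\} \text{ and } m \text{ is squarefree},\\ 0,&\text{otherwise},\end{cases}$$ where $d_0=d_1=1$, $d_2=4$, $d_3=16$.
   Context: For $n\in\mathbb{N}$ and $k\in\mathbb{Z}$, $c_n(k)=\sum_{1\le j\le n,\ \gcd(j,n)=1}\exp(2\pi i jk/n)$ is the Ramanujan sum. $\psi(n)=n\prod_{p\mid n}(1+1/p)$ is the Dedekind function. *)

(* Defs.v *)
From mathcomp Require Export all_boot all_order all_algebra.
From mathcomp Require Export reals sequences exp trigo.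
From mathcomp Require Export complex.
Set Implicit Arguments.
Unset Strict Implicit.
Unset Printing Implicit Defensive.
Import GRing.Theory Num.Theory.
Local Open Scope ring_scope.
Local Open Scope complex_scope.

Definition cexp (R : realType) (z : R[i]) : R[i] :=
  let: a +i* b := z in (expR a)%:C * (cos b +i* sin b).

Definition ramanujan_sum (R : realType) (n : nat) (k : int) : R[i] :=
  \sum_(1 <= j < n.+1 | coprime j n)
    cexp (2 * pi%:C * 'i%C * j%:R * k%:~R / n%:R).

Definition dedekind_psi (F : fieldType) (n : nat) : F :=
  n%:R * \prod_(p <- primes n) (1 + p%:R^-1).

Definition squarefree (n : nat) : Prop :=
  forall d : nat, (d ^ 2 %| n)%N -> d = 1%N.

(* Only the values at j <= 3 are meaningful. *)
Definition d_coef (j : nat) : nat := nth 0%N [:: 1; 1; 4; 16]%N j.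

(* Main.v *)
(** With z = exp(2 pi i / n), the sum is S(n, z), the sum of z^(j (k^2 - 1)) over
    pairs (j, k) of residues coprime to n.

    If p^2 | n for an odd prime p put s = n / p; if 16 | n put p = 2, s = n / 4.
    Then n | s^2, every prime factor of n divides s, and w = z^(2 s) is a
    primitive p-th root of unity. Hence k -> k + t s permutes the residues
    coprime to n and multiplies z^(j k^2) by w^(j k t); summing over t < p
    gives 0.

    Otherwise, by the Chinese remainder theorem z = x y implies
    S(a b, z) = S(a, x) S(b, y) for coprime a, b. For an odd prime p, the sum
    over j is p - 1 for k = 1, p - 1 and is -1 for the other k, so
    S(p, z) = 2 (p - 1) - (p - 3) = p + 1. If e <= 3, all odd squares are 1
    modulo 2^e, so S(2^e, z) = totient(2^e)^2. *)
Require Import Defs.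
From mathcomp Require Import zify ring lra.
Set Implicit Arguments.
Unset Strict Implicit.
Import GRing.Theory Num.Theory.
Local Open Scope ring_scope.
Local Open Scope complex_scope.

(** * Sums over residues and over powers of a root of unity *)

Lemma expr_eq_mod (F : nzRingType) (n : nat) (z : F) (i k : nat) :
  z ^+ n = 1 -> i = k %[mod n] -> z ^+ i = z ^+ k.
Proof. by move=> zn ik; rewrite -(expr_mod i zn) ik expr_mod. Qed.

Lemma sum_expr_unity_root (F : idomainType) (p : nat) (y : F) :
  y ^+ p = 1 -> y != 1 -> \sum_(t < p) y ^+ t = 0.
Proof.
move=> yp yN1; apply/eqP; have := subrX1 y p.
by rewrite yp subrr => /esym/eqP; rewrite mulf_eq0 subr_eq0 (negPf yN1).
Qed.

(** Adding [s] modulo [n] is injective on residues, hence a permutation; periodicity of [P] and [f]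
    absorbs the reduction. *)
Lemma sum_periodic_shift (V : nmodType) (n s : nat) (P : pred nat) (f : nat -> V) :
    (forall k, P (k %% n)%N = P k) -> (forall k, f (k %% n)%N = f k) ->
  \sum_(k < n | P k) f k = \sum_(k < n | P (k + s)%N) f (k + s)%N.
Proof.
case: n => [|n] PE fE; first by rewrite !big_ord0.
pose h (k : 'I_n.+1) : 'I_n.+1 := inord ((k + s) %% n.+1).
have hE k : h k = ((k + s) %% n.+1)%N :> nat by rewrite inordK ?ltn_pmod.
have h_inj : injective h.
  move=> x y /(congr1 (@nat_of_ord _)); rewrite !hE => /eqP.
  by rewrite eqn_modDr !modn_small // => /eqP/val_inj.
rewrite (reindex_inj h_inj) /=.
by apply: eq_big => k; rewrite hE ?PE ?fE.
Qed.

(** The Chinese remainder bijection matches units modulo [a * b] with pairs of units. *)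
Lemma sum_coprime_mul (F : comNzRingType) (a b : nat) (f g : nat -> F) :
    (0 < a)%N -> (0 < b)%N -> coprime a b ->
  \sum_(k < a * b | coprime k (a * b)) f (k %% a)%N * g (k %% b)%N =
  (\sum_(k < a | coprime k a) f k) * (\sum_(k < b | coprime k b) g k).
Proof.
move=> a0 b0 cab; rewrite big_distrlr /= pair_big /=.
have ab0 : (0 < a * b)%N by rewrite muln_gt0 a0.
pose h (x : 'I_a * 'I_b) : 'I_(a * b) :=
  Ordinal (ltn_pmod (chinese a b x.1 x.2) ab0).
pose h' (k : 'I_(a * b)) : 'I_a * 'I_b :=
  (Ordinal (ltn_pmod k a0), Ordinal (ltn_pmod k b0)).
have hl x : (h x %% a = x.1)%N.
  by rewrite /= modn_dvdm ?dvdn_mulr // chinese_modl // modn_small.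
have hr x : (h x %% b = x.2)%N.
  by rewrite /= modn_dvdm ?dvdn_mull // chinese_modr // modn_small.
have hh' : cancel h' h.
  by move=> k; apply: val_inj; rewrite /= -chinese_mod // modn_small.
have h'h : cancel h h'.
  move=> x; have := hl x; have := hr x; rewrite /h'; case: x => x y /= hy hx.
  by congr (_, _); apply: val_inj.
rewrite (reindex h) /=; last by exists h'.
apply: eq_big => [x|x _]; last by rewrite hl hr.
by rewrite coprimeMr -(coprime_modl _ a) -(coprime_modl _ b) hl hr.
Qed.

(** * The double sum over units and its multiplicativity *)

(** The quotient encodes z^(j (k^2 - 1)) without truncated subtraction, which would be wrong at
    [k = 0]. *)
Definition square_unit_sum (F : fieldType) (n : nat) (z : F) : F :=
  \sum_(j < n | coprime j n) \sum_(k < n | coprime k n)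
    z ^+ (j * k ^ 2) / z ^+ j.

(** The summand splits into a factor depending on [j], [k] modulo [a] and one depending on them
    modulo [b], so [sum_coprime_mul] applies to the sum over [j] and again to the sum over [k]. *)
Lemma square_unit_sum_mul (F : fieldType) (a b : nat) (y z : F) :
    (0 < a)%N -> (0 < b)%N -> coprime a b -> y ^+ a = 1 -> z ^+ b = 1 ->
  square_unit_sum (a * b) (y * z) = square_unit_sum a y * square_unit_sum b z.
Proof.
move=> a0 b0 cab ya zb.
pose f (j : nat) := \sum_(k < a | coprime k a) y ^+ (j * k ^ 2) / y ^+ j.
pose g (j : nat) := \sum_(k < b | coprime k b) z ^+ (j * k ^ 2) / z ^+ j.
rewrite /square_unit_sum -[RHS](sum_coprime_mul f g) //; apply: eq_bigr => j _.
rewrite -[RHS](sum_coprime_mul (fun k => y ^+ ((j %% a) * k ^ 2) / y ^+ (j %% a)%N)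
  (fun k => z ^+ ((j %% b) * k ^ 2) / z ^+ (j %% b)%N)) //.
apply: eq_bigr => k _.
rewrite !exprMn invfM mulrACA !(expr_mod _ ya) !(expr_mod _ zb).
congr (_ / _ * (_ / _)).
  by apply: (expr_eq_mod ya); rewrite -[RHS]modnMm modn_mod modnXm modnMm.
by apply: (expr_eq_mod zb); rewrite -[RHS]modnMm modn_mod modnXm modnMm.
Qed.

(** Take [c] congruent to 1, 0 and [d] to 0, 1 modulo [a], [b]. Then c + d is 1 modulo [a * b], so z
    = z^c z^d, and gcd(c, ab) = b gives z^c the order [a]; likewise for z^d. *)
Lemma prim_root_coprime_split (F : fieldType) (a b : nat) (z : F) :
    coprime a b -> (a * b).-primitive_root z ->
  exists x y : F, [/\ a.-primitive_root x, b.-primitive_root y & z = x * y].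
Proof.
move=> cab pz; have ab0 := prim_order_gt0 pz.
have /andP[a0 b0] : (0 < a)%N && (0 < b)%N by rewrite -muln_gt0.
pose c := chinese a b 1 0; pose d := chinese a b 0 1.
have bc : (b %| c)%N by rewrite /dvdn /c chinese_modr // mod0n.
have ad : (a %| d)%N by rewrite /dvdn /d chinese_modl // mod0n.
have ca : coprime c a by rewrite -coprime_modl chinese_modl // coprime_modl coprime1n.
have db : coprime d b by rewrite -coprime_modl chinese_modr // coprime_modl coprime1n.
have gc : gcdn c (a * b) = b by rewrite Gauss_gcdr //; apply/gcdn_idPr.
have gd : gcdn d (a * b) = a by rewrite Gauss_gcdl //; apply/gcdn_idPr.
exists (z ^+ c), (z ^+ d); split.
- by have := exp_prim_root pz c; rewrite gc mulnK.
- by have := exp_prim_root pz d; rewrite gd mulKn.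
rewrite -exprD -[LHS]expr1; apply/eqP; rewrite (eq_prim_root_expr pz).
rewrite chinese_remainder //; apply/andP; split; rewrite -(modnDm c d).
  by rewrite (eqP ad) addn0 modn_mod chinese_modl.
by rewrite (eqP bc) modn_mod chinese_modr.
Qed.

Lemma prim_root_neq0 (F : fieldType) (n : nat) (z : F) :
  n.-primitive_root z -> z != 0.
Proof.
move=> pz; apply/eqP => z0; have /eqP := prim_expr_order pz.
by rewrite z0 expr0n gtn_eqF ?(prim_order_gt0 pz) // eq_sym oner_eq0.
Qed.

(** * Odd prime modulus *)

Lemma square_unit_sum_prime (F : fieldType) (p : nat) (z : F) :
  prime p -> odd p -> p.-primitive_root z -> square_unit_sum p z = p.+1%:R.
Proof.
move=> pp op pz; have p1 := prime_gt1 pp; have zp := prim_expr_order pz.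
have z0 := prim_root_neq0 pz.
have split0 (g : nat -> F) :
    \sum_(k < p | coprime k p) g k = \sum_(k < p) g k - g 0%N.
  rewrite [in RHS](bigD1 (Ordinal (ltnW p1))) //= addrAC subrr add0r.
  apply: eq_bigl => k; rewrite -val_eqE /= -lt0n; case: (posnP k) => [->|k0].
    by rewrite /coprime gcd0n gtn_eqF.
  by rewrite coprime_sym prime_coprime // gtnNdvd.
rewrite /square_unit_sum exchange_big /=.
have inner k : \sum_(j < p | coprime j p) z ^+ (j * k ^ 2) / z ^+ j =
   p%:R * ((k ^ 2 == 1 %[mod p])%N)%:R - 1.
  (* Over all [j < p] the geometric series in [y] sums to [p] if [y = 1] and to 0 otherwise;
     dropping [j = 0] subtracts 1. *)
  pose y := z ^+ (k ^ 2) / z.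
  have yp : y ^+ p = 1 by rewrite /y expr_div_n -exprM mulnC exprM zp expr1n divr1.
  have y1 : (y == 1) = (k ^ 2 == 1 %[mod p])%N.
    rewrite -(eq_prim_root_expr pz) expr1 -[in LHS](divff z0).
    by rewrite (inj_eq (mulIf _)) ?invr_eq0.
  under eq_bigr => j _ do rewrite mulnC exprM -expr_div_n -/y.
  rewrite split0 expr0; congr (_ - 1); rewrite -y1; case: eqVneq => [->|yN1].
    by under eq_bigr do rewrite expr1n; rewrite sumr_const card_ord mulr1.
  by rewrite mulr0 sum_expr_unity_root.
under eq_bigr do rewrite inner.
rewrite (split0 (fun k => p%:R * (k ^ 2 == 1 %[mod p])%:R - 1)).
rewrite big_split /= sumr_const card_ord -big_distrr /=.
have sq1 (k : 'I_p) : (k ^ 2 == 1 %[mod p]) = (k == 1 :> nat) || (k == p.-1 :> nat).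
  have kp := ltn_ord k; case: (posnP k) => [->|k0].
    by rewrite mod0n modn_small //; lia.
  (* As [k > 0], the subtraction is genuine: [p] divides (k - 1)(k + 1), and [k < p] leaves only
     [k = 1] or [k = p - 1]. *)
  rewrite eqn_mod_dvd ?expn_gt0 ?k0 // -[X in (_ - X)%N](exp1n 2) subn_sqr.
  rewrite Euclid_dvdM //; congr (_ || _); apply/idP/idP.
  - by move/dvdnP=> [q]; case: q => [|q]; lia.
  - by move/eqP->; rewrite subnn dvdn0.
  - by move/dvdnP=> [q]; case: q => [|[|q]]; lia.
  - by move/eqP->; rewrite addn1 prednK ?dvdnn // ltnW.
have pm : (p.-1 < p)%N by lia.
have -> : \sum_(k < p) (k ^ 2 == 1 %[mod p])%:R = 2 :> F.
  (* The residues 1 and [p - 1] are distinct because [p] is odd. *)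
  rewrite (bigD1 (Ordinal p1)) //= (bigD1 (Ordinal pm)) /=; last first.
    by rewrite -val_eqE /=; move: p1 op; case: (p) => [|[|[|?]]].
  rewrite !(sq1 (Ordinal _)) /= !eqxx orbT big1 ?addr0 // => k /andP[k1 k2].
  by rewrite sq1; move: k1 k2; rewrite -!val_eqE /= => /negPf-> /negPf->.
(* The excluded term [k = 0] equals -1, so the total is 2p - p + 1. *)
rewrite mod0n modn_small //= -natr1; ring.
Qed.

(** * Vanishing by shifting [k] *)

Lemma sum_square_eq0 (F : numFieldType) (n p s j : nat) (z : F) :
    prime p -> (p %| n)%N -> (n %| s ^ 2)%N ->
    (forall k, coprime (k + s) n = coprime k n) ->
    n.-primitive_root z -> p.-primitive_root (z ^+ (2 * s)) -> coprime j n ->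
  \sum_(k < n | coprime k n) z ^+ (j * k ^ 2) = 0.
Proof.
move=> pp pn ns cops pz pw cj; set S := LHS; have zn := prim_expr_order pz.
have shift t : S = \sum_(k < n | coprime k n) z ^+ (j * k ^ 2) * (z ^+ (2 * s)) ^+ (j * k) ^+ t.
  rewrite /S (@sum_periodic_shift _ _ (t * s) (fun k => coprime k n) (fun k => z ^+ (j * k ^ 2))).
  - apply: eq_big => [k|k _].
      elim: t => [|t IH]; first by rewrite mul0n addn0.
      by rewrite mulSn (addnC s) addnA cops.
    rewrite -!exprM -exprD; apply: (expr_eq_mod zn).
    (* The first summand disappears modulo [n] since [n] divides s^2. *)
    have -> : (j * (k + t * s) ^ 2 = j * t ^ 2 * s ^ 2 + (j * k ^ 2 + 2 * s * (j * k * t)))%N by lia.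
    by rewrite -modnDml (eqP (dvdn_mull _ ns)).
  - by move=> k; rewrite coprime_modl.
  - by move=> k; apply: (expr_eq_mod zn); rewrite -modnMmr modnXm modnMmr.
(* For each [k] the sum over [t] is geometric with ratio w^(jk), w = z^(2s), which is not 1 because
   [p] does not divide [j * k]. Thus p S = 0, and [p] is nonzero in characteristic 0. *)
have : \sum_(t < p) S = 0.
  under eq_bigr => t _ do rewrite (shift t).
  rewrite exchange_big big1 //= => k ck; rewrite -big_distrr /=.
  rewrite sum_expr_unity_root ?mulr0 //.
    by rewrite [LHS]exprAC (prim_expr_order pw) expr1n.
  rewrite -(prim_order_dvd pw) -prime_coprime // coprime_sym coprimeMl.
  by rewrite !(coprime_dvdr pn).
rewrite sumr_const card_ord -mulr_natr => /eqP; rewrite mulf_eq0 pnatr_eq0.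
by rewrite -[p == _]negbK -lt0n prime_gt0 // orbF => /eqP.
Qed.

(** A prime factor of [n] divides [s], so it divides [k + s] exactly when it divides [k]. *)
Lemma coprime_addr_primes (n s : nat) :
    (0 < n)%N -> (forall q, prime q -> (q %| n)%N -> (q %| s)%N) ->
  forall k, coprime (k + s) n = coprime k n.
Proof.
move=> n0 qs k.
have cop (a b : nat) : (forall q, prime q -> (q %| n)%N -> (q %| b)%N -> (q %| a)%N) ->
    coprime a n -> coprime b n.
  move=> ba ca; rewrite /coprime eqn_leq gcdn_gt0 n0 orbT andbT leqNgt.
  apply/negP => g1; have pq := pdiv_prime g1.
  have := pdiv_dvd (gcdn b n); rewrite dvdn_gcd => /andP[qb qn].
  have : (pdiv (gcdn b n) %| gcdn a n)%N by rewrite dvdn_gcd qn ba.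
  by rewrite (eqP ca) Euclid_dvd1.
by apply/idP/idP; apply: cop => q pq qn; rewrite dvdn_addl ?qs.
Qed.

Lemma square_unit_sum_eq0 (F : numFieldType) (n p s : nat) (z : F) :
    prime p -> (p %| n)%N -> (n %| s ^ 2)%N ->
    (forall q, prime q -> (q %| n)%N -> (q %| s)%N) ->
    n.-primitive_root z -> p.-primitive_root (z ^+ (2 * s)) ->
  square_unit_sum n z = 0.
Proof.
move=> pp pn ns qs pz pw; rewrite /square_unit_sum big1 // => j cj.
have cops := coprime_addr_primes (prim_order_gt0 pz) qs.
by rewrite -big_distrl /= (sum_square_eq0 pp pn ns) ?mul0r.
Qed.

Lemma prime_dvdn_sqr (q d : nat) : prime q -> (q %| d ^ 2)%N = (q %| d)%N.
Proof. by move=> pq; rewrite Euclid_dvdX ?andbT. Qed.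

(** With n = r p^2 and s = r p, gcd(2s, n) = s because [p] is odd, so z^(2s) has order n / s = p. *)
Lemma square_unit_sum_odd_sqr (F : numFieldType) (n p : nat) (z : F) :
    prime p -> odd p -> (p ^ 2 %| n)%N -> n.-primitive_root z ->
  square_unit_sum n z = 0.
Proof.
move=> pp op /dvdnP[r def_n] pz; have p0 := prime_gt0 pp.
have n0 := prim_order_gt0 pz; have r0 : (0 < r)%N by lia.
have defs : (n = p * (r * p))%N by lia.
have nds : (n %| (r * p) ^ 2)%N by apply/dvdnP; exists r; lia.
apply: (square_unit_sum_eq0 pp _ nds _ pz).
- by rewrite defs dvdn_mulr.
- by move=> q pq qn; rewrite -prime_dvdn_sqr // (dvdn_trans qn).
have := exp_prim_root pz (2 * (r * p))%N.
rewrite [in gcdn _ n]defs -muln_gcdl.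
have -> : gcdn 2 p = 1%N by apply/eqP; rewrite -/(coprime 2 p) coprime2n.
by rewrite mul1n defs mulnK // muln_gt0 r0.
Qed.

(** With n = 16 r and s = 4 r, s^2 = r n and 2s = n / 2, so z^(2s) has order 2. *)
Lemma square_unit_sum_dvd16 (F : numFieldType) (n : nat) (z : F) :
  (16 %| n)%N -> n.-primitive_root z -> square_unit_sum n z = 0.
Proof.
move=> /dvdnP[r def_n] pz; have n0 := prim_order_gt0 pz.
have nds : (n %| (r * 4) ^ 2)%N by apply/dvdnP; exists r; lia.
apply: (@square_unit_sum_eq0 _ _ 2 _ _ isT _ nds _ pz).
- by apply/dvdnP; exists (r * 8)%N; lia.
- by move=> q pq qn; rewrite -prime_dvdn_sqr // (dvdn_trans qn).
have := exp_prim_root pz (2 * (r * 4))%N.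
have -> : (n = 2 * (2 * (r * 4)))%N by lia.
by rewrite gcdnMl mulnK //; lia.
Qed.

(** * The moduli 1, 2, 4 and 8 *)

Lemma square_unit_sum_two_pow (F : fieldType) (j : nat) (z : F) :
  (j <= 3)%N -> (2 ^ j).-primitive_root z ->
  square_unit_sum (2 ^ j) z = (d_coef j)%:R.
Proof.
move=> j3 pz; have z0 := prim_root_neq0 pz.
(* Settled by enumerating all [j <= 3] and [k < 8]. *)
have sq1 (k : 'I_(2 ^ j)) : coprime k (2 ^ j) -> k ^ 2 = 1 %[mod 2 ^ j].
  case: k => k kj /= ck; apply/eqP; move: ck; apply/implyP.
  by move: j3 k kj {pz}; do 4 ?[case: j => [|j]] => // _; do 8 ?case=> //.
transitivity (((\sum_(k < 2 ^ j | coprime k (2 ^ j)) 1) ^ 2)%N%:R : F).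
  rewrite /square_unit_sum natrX expr2 natr_sum big_distrlr /=.
  apply: eq_bigr => i _; apply: eq_bigr => k ck; rewrite mulr1.
  rewrite (expr_eq_mod (prim_expr_order pz) (k := i)) ?divff ?expf_neq0 //.
  by rewrite -modnMmr sq1 // modnMmr muln1.
congr _%:R; move: j3 {pz sq1}; do 4 ?[case: j => [|j]] => // _.
all: by rewrite big_mkcond /= !big_ord_recl big_ord0.
Qed.

(** * Squarefree odd part and the Dedekind function *)

(** If d^2 divides [m] with [d > 1], so does the square of any prime factor of [d]. The boolean form
    yields a witness prime when [m] is not squarefree. *)
Lemma squarefreeP (m : nat) : (0 < m)%N ->
  reflect (squarefree m) (all (fun p => ~~ (p ^ 2 %| m)%N) (primes m)).
Proof.
move=> m0; apply: (iffP allP) => [nsq d dm | sqf p].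
  case: d dm => [|[|d]] dm //; first by rewrite dvd0n gtn_eqF in dm.
  have pp := @pdiv_prime d.+2 isT; have pd := pdiv_dvd d.+2.
  have p2m := dvdn_trans (dvdn_exp2r 2 pd) dm.
  have := nsq (pdiv d.+2); rewrite p2m mem_primes pp m0 /=.
  by rewrite (dvdn_trans _ p2m) ?dvdn_exp // => /(_ isT).
by rewrite mem_primes => /and3P[pp _ _]; apply/negP => /sqf p1; rewrite p1 in pp.
Qed.

(** The new prime contributes p (1 + 1/p) = p + 1, the value of the double sum at [p]. *)
Lemma dedekind_psi_mul_prime (F : numFieldType) (p m : nat) :
    prime p -> (0 < m)%N -> ~~ (p %| m)%N ->
  dedekind_psi F (p * m) = p.+1%:R * dedekind_psi F m.
Proof.
move=> pp m0 pm; have p0 := prime_gt0 pp; rewrite /dedekind_psi.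
have /(perm_big _)-> : perm_eq (primes (p * m)) (p :: primes m).
  apply: uniq_perm => [||q]; first exact: primes_uniq.
    by rewrite /= primes_uniq mem_primes pp m0 pm.
  by rewrite primesM // inE primes_prime // inE.
rewrite big_cons natrM mulrACA mulrDr mulr1 divff ?pnatr_eq0 -?lt0n //.
by rewrite natr1.
Qed.

(** Strong induction on [m], splitting off its least prime factor [p]; squarefreeness makes [p]
    coprime to the cofactor [r], and oddness makes it coprime to 2^j. *)
Lemma square_unit_sum_squarefree (F : numFieldType) (j m : nat) (z : F) :
    (j <= 3)%N -> odd m -> squarefree m -> (2 ^ j * m).-primitive_root z ->
  square_unit_sum (2 ^ j * m) z = (d_coef j)%:R * dedekind_psi F m.
Proof.
move=> j3; elim/ltn_ind: m z => m IH z om sqf pz.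
have [m1|m1] := leqP m 1.
  have m1' : m = 1%N by case: m m1 om {IH sqf pz} => [|[]].
  rewrite m1' muln1 in pz *; rewrite square_unit_sum_two_pow //.
  by rewrite /dedekind_psi big_nil !mulr1.
have pp := pdiv_prime m1; have [r] := dvdnP (pdiv_dvd m).
set p := pdiv m in pp *; rewrite mulnC => def_m; have p1 := prime_gt1 pp.
have /andP[op or] : odd p && odd r by rewrite -oddM -def_m.
have r0 : (0 < r)%N by apply: odd_gt0.
have pr : ~~ (p %| r)%N.
  apply/negP => pr; have /sqf p1' : (p ^ 2 %| m)%N by rewrite def_m dvdn_pmul2l ?(ltnW p1).
  by rewrite p1' in p1.
have cpr : coprime p (2 ^ j * r).
  by rewrite coprimeMr coprimeXr ?coprimen2 //= prime_coprime.
have defn : (2 ^ j * m = p * (2 ^ j * r))%N by rewrite def_m mulnCA.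
rewrite defn in pz *; have [x [y [px py ->]]] := prim_root_coprime_split cpr pz.
rewrite square_unit_sum_mul ?prim_expr_order //; first last.
- by rewrite muln_gt0 expn_gt0.
- exact: ltnW.
rewrite square_unit_sum_prime // IH //; first last.
- by move=> d dr; apply: sqf; rewrite def_m dvdn_mull.
- by rewrite def_m ltn_Pmull.
by rewrite [in RHS]def_m dedekind_psi_mul_prime // mulrCA.
Qed.

(** * The complex exponential and primitive roots of unity *)

Lemma cexpD (R : realType) (x y : R[i]) : cexp (x + y) = cexp x * cexp y.
Proof.
case: x y => [a b] [c d]; rewrite /cexp /= expRD cosD sinD.
apply/eqP; rewrite eq_complex /=; apply/andP; split; apply/eqP; ring.
Qed.

Lemma cexp0 (R : realType) : cexp (0 : R[i]) = 1.
Proof. by rewrite /cexp /= expR0 cos0 sin0 mul1r. Qed.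

Lemma cexpMn (R : realType) (x : R[i]) (n : nat) : cexp (x *+ n) = cexp x ^+ n.
Proof.
by elim: n => [|n IH]; rewrite ?mulr0n ?cexp0 // mulrS cexpD IH exprS.
Qed.

Lemma cexp_neq0 (R : realType) (x : R[i]) : cexp x != 0.
Proof.
apply/eqP => x0; have := cexpD x (- x); rewrite subrr cexp0 x0 mul0r.
exact/eqP/oner_neq0.
Qed.

Lemma cexpN (R : realType) (x : R[i]) : cexp (- x) = (cexp x)^-1.
Proof.
by apply: (mulfI (cexp_neq0 x)); rewrite -cexpD subrr cexp0 divff ?cexp_neq0.
Qed.

Definition root_of_unity (R : realType) (n : nat) : R[i] :=
  cexp (2 * pi%:C * 'i%C / n%:R).

Lemma root_of_unity_expr (R : realType) (n k : nat) :
  root_of_unity R n ^+ k =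
    cos ((pi *+ 2) * k%:R / n%:R) +i* sin ((pi *+ 2) * k%:R / n%:R).
Proof.
rewrite -cexpMn.
have -> : (2 * pi%:C * 'i%C / n%:R) *+ k = 0 +i* ((pi *+ 2) * k%:R / n%:R) :> R[i].
  rewrite [RHS]complexE /= !rmorphM rmorphMn fmorphV !rmorph_nat add0r.
  by ring.
by rewrite /cexp expR0 mul1r.
Qed.

(** For 0 < k < n put x = pi k / n, which lies strictly between 0 and pi. If the k-th power were 1,
    then cos(2x) = 1 would force sin x = 0. *)
Lemma root_of_unity_primitive (R : realType) (n : nat) :
  (0 < n)%N -> n.-primitive_root (root_of_unity R n).
Proof.
move=> n0; have nR0 : n%:R != 0 :> R by rewrite pnatr_eq0 -lt0n.
apply/andP; split => //; apply/forallP => k; rewrite unity_rootE; apply/eqP.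
rewrite root_of_unity_expr; have [->|kn] := eqVneq k.+1 n.
  by rewrite mulfK // cos2pi sin2pi eqxx.
apply/negbTE; rewrite eq_complex /= negb_and; apply/orP; left.
set x : R := pi * (k.+1%:R / n%:R).
have -> : pi *+ 2 * k.+1%:R / n%:R = x *+ 2 :> R by rewrite /x; ring.
have kn' : (k.+1 < n)%N by rewrite ltn_neqAle kn ltn_ord.
have x_bd : 0 < x < pi.
  rewrite /x mulr_gt0 ?pi_gt0 ?divr_gt0 ?ltr0n //=.
  by rewrite gtr_pMr ?pi_gt0 // ltr_pdivrMr ?ltr0n // mul1r ltr_nat.
have := sin_gt0_pi x_bd; rewrite Order.POrderTheory.lt_def => /andP[+ _].
rewrite cos_mulr2n cos2sin2; apply: contra => /eqP xE.
by rewrite -sqrf_eq0; apply/eqP; lra.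
Qed.

(** * From Ramanujan sums to the double sum *)

(** Passes from the range 1..n of the statement to the residues 0..n-1 by trading the index [n] for
    0. *)
Lemma sum_nat1_periodic (V : zmodType) (n : nat) (P : pred nat) (f : nat -> V) :
    (0 < n)%N -> P n = P 0%N -> f n = f 0%N ->
  \sum_(1 <= k < n.+1 | P k) f k = \sum_(k < n | P k) f k.
Proof.
move=> n0 Pn fn; rewrite -(big_mkord P) big_mkcond [RHS]big_mkcond.
by rewrite big_nat_recr //= [RHS]big_ltn // addrC Pn fn.
Qed.

Lemma ramanujan_sumE (R : realType) (n k : nat) : (0 < n)%N ->
  ramanujan_sum R n (k%:Z ^+ 2 - 1) =
  \sum_(j < n | coprime j n)
     root_of_unity R n ^+ (j * k ^ 2) / root_of_unity R n ^+ j.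
Proof.
move=> n0; have zn := prim_expr_order (root_of_unity_primitive R n0).
pose f j := root_of_unity R n ^+ (j * k ^ 2) / root_of_unity R n ^+ j.
rewrite -(@sum_nat1_periodic _ _ (fun j => coprime j n) f) //; first last.
- by rewrite /f mul0n zn exprM zn expr1n.
- by rewrite /coprime gcdnn gcd0n.
apply: eq_bigr => j _; rewrite /f -!cexpMn -cexpN -cexpD; congr cexp.
rewrite rmorphB rmorphXn /= -[k%:~R]/(k%:R).
rewrite -!(mulr_natr (_ / _)) natrM natrX; ring.
Qed.

Unset Implicit Arguments.

Theorem corollary11 (R : realType) (n j m : nat)
    (hn : n = (2 ^ j * m)%N) (hm : odd m) :
  ((j <= 3)%N /\ squarefree m ->
     \sum_(1 <= k < n.+1 | coprime k n) ramanujan_sum R n (k%:Z ^+ 2 - 1)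
       = (d_coef j)%:R * dedekind_psi R[i] m) /\
  (~ ((j <= 3)%N /\ squarefree m) ->
     \sum_(1 <= k < n.+1 | coprime k n) ramanujan_sum R n (k%:Z ^+ 2 - 1)
       = 0).
Proof.
have m0 : (0 < m)%N by apply: odd_gt0.
have n0 : (0 < n)%N by rewrite hn muln_gt0 expn_gt0.
have pz := root_of_unity_primitive R n0; have zn := prim_expr_order pz.
have -> : \sum_(1 <= k < n.+1 | coprime k n) ramanujan_sum R n (k%:Z ^+ 2 - 1)
    = square_unit_sum n (root_of_unity R n).
  rewrite [RHS]exchange_big /=.
  under eq_bigr do rewrite ramanujan_sumE //.
  apply: (@sum_nat1_periodic _ _ (fun k => coprime k n) (fun k =>
    \sum_(i < n | coprime i n)
      root_of_unity R n ^+ (i * k ^ 2) / root_of_unity R n ^+ i)) => //.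
    by rewrite /coprime gcdnn gcd0n.
  apply: eq_bigr => i _; congr (_ / _); apply: (expr_eq_mod zn).
  by rewrite muln0 mod0n -mulnn mulnA modnMl.
split=> [[j3 sqf]|H].
  by move: pz; rewrite hn; apply: square_unit_sum_squarefree.
(* If [j > 3], then 16 divides [n]; otherwise [m] is not squarefree and supplies a prime [p], odd as
   a divisor of [m], whose square divides [n]. *)
have [j3|j3] := leqP j 3; last first.
  by apply: square_unit_sum_dvd16 pz; rewrite hn dvdn_mulr // (dvdn_exp2l 2 j3).
have /allPn[p] : ~~ all (fun p => ~~ (p ^ 2 %| m)%N) (primes m).
  by apply/negP => /(squarefreeP m0) sqf; apply: H.
rewrite mem_primes => /and3P[pp _ pm] /negPn p2m.
apply: (square_unit_sum_odd_sqr pp _ _ pz); first exact: dvdn_odd pm hm.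
by rewrite hn dvdn_mull.
Qed.
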